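(* Consider the two-dimensional quadratic cheap talk game in which the source $\vec{m}$ is uniformly distributed on $[0,1]\times[0,1]$, the encoder cost is $c^e(\vec{m},\vec{u})=\|\vec{m}-\vec{u}-\vec{b}\|^2$ and the decoder cost is $c^d(\vec{m},\vec{u})=\|\vec{m}-\vec{u}\|^2$. Then a Nash equilibrium encoder policy can be non-discrete and even linear; that is, there exist a nonzero bias vector $\vec{b}\in\mathbb{R}^2$ and a Nash equilibrium of the corresponding game in which the encoder policy is non-discrete (not equivalent to a quantized policy) and is a linear function of $\vec{m}$.
   Context: $\|\cdot\|$ is the Euclidean norm on $\mathbb{R}^2$. The encoder observes $\vec{m}$ and sends $\vec{x}=\gamma^e(\vec{m})\in\mathbb{R}^2$; the decoder receives $\vec{x}$ without noise and chooses $\vec{u}=\gamma^d(\vec{x})\in\mathbb{R}^2$; both policies are measurable functions. The costs to be minimized are $J^e(\gamma^e,\gamma^d)=\mathbb{E}[c^e(\vec{m},\vec{u})]$ for the encoder and $J^d(\gamma^e,\gamma^d)=\mathbb{E}[c^d(\vec{m},\vec{u})]$ for the decoder. A pair $(\gamma^{*,e},\gamma^{*,d})$ is a Nash equilibrium if $J^e(\gamma^{*,e},\gamma^{*,d})\le J^e(\gamma^e,\gamma^{*,d})$ for all $\gamma^e$ and $J^d(\gamma^{*,e},\gamma^{*,d})\le J^d(\gamma^{*,e},\gamma^d)$ for all $\gamma^d$. A policy is quantized (discrete) if it takes at most countably many values. *)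

(* Defs.v *)
From HB Require Import structures.
From mathcomp Require Import all_boot all_order all_algebra.
From mathcomp Require Import all_classical all_reals all_analysis.
Set Implicit Arguments.
Unset Strict Implicit.
Unset Printing Implicit Defensive.
Import Order.TTheory GRing.Theory Num.Theory.
Import numFieldNormedType.Exports.
Local Open Scope classical_set_scope.
Local Open Scope ring_scope.

(* The library norm on a product type is the sup norm, hence this one. *)
Definition euclid_norm (R : realType) (v : R * R) : R :=
  Num.sqrt (v.1 ^+ 2 + v.2 ^+ 2).

(* [measurableTypeR R] is [R] with its Borel sigma-algebra, in the form over
   which the library states [uniform_prob]. *)
Definition uniform01 (R : realType) : probability (measurableTypeR R) R :=
  uniform_prob (@ltr01 R).

Definition uniform_square (R : realType) :
    probability (measurableTypeR R * measurableTypeR R)%type R :=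
  (uniform01 R \x uniform01 R)%E.

Definition encoder_cost (R : realType) (b m u : R * R) : R :=
  euclid_norm (m - u - b) ^+ 2.

Definition decoder_cost (R : realType) (m u : R * R) : R :=
  euclid_norm (m - u) ^+ 2.

(* Encoder policies are taken on the whole plane; only their values on the unit
   square, which carries the source, contribute to the costs. *)
Definition policy (R : realType) (g : R * R -> R * R) : Prop :=
  measurable_fun [set: R * R] g.

(* Expected costs are extended reals: they are +oo for policies whose squared
   error is not integrable. *)
Definition expected_cost (R : realType) (c : R * R -> R * R -> R)
    (ge gd : R * R -> R * R) : \bar R :=
  ('E_(uniform_square R)[fun m => c m (gd (ge m))])%E.

Definition nash_equilibrium (R : realType) (b : R * R)
    (ge gd : R * R -> R * R) : Prop :=
  let Je := expected_cost (encoder_cost b) in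
  let Jd := expected_cost (@decoder_cost R) in
  [/\ policy ge, policy gd,
      forall ge', policy ge' -> (Je ge gd <= Je ge' gd)%E
    & forall gd', policy gd' -> (Jd ge gd <= Jd ge gd')%E].

Definition quantized (R : realType) (g : R * R -> R * R) : Prop :=
  policy g /\ countable (range g).

(* Encoder policies are identified when they agree for almost every source
   value. *)
Definition non_discrete (R : realType) (ge : R * R -> R * R) : Prop :=
  ~ exists g, quantized g /\ {ae uniform_square R, forall m, ge m = g m}.

(* Main.v *)
Require Import Defs.
From mathcomp Require Import all_boot all_order all_algebra.
From mathcomp Require Import all_classical all_reals all_analysis.
From mathcomp Require Import measurable_realfun ring lra.
Import Order.TTheory GRing.Theory Num.Theory.
Import numFieldNormedType.Exports.
Local Open Scope ring_scope.

(** Take the bias [(0, 1)], the encoder [m |-> (m.1, 0)] and the decoder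
    [x |-> (x.1, 1 / 2)].  The second action does not depend on the message, so
    the encoder can only influence the first coordinate, along which there is no
    bias and its error is already [0].  The message carries no information on
    [m.2], so on each section [m.1 = x] the decoder can do no better than the
    mean [1 / 2] of [m.2].  The encoder takes values in a countable set only on
    countably many vertical lines, which form a null set. *)

Lemma sqr_euclid_norm (R : realType) (v : R * R) :
  euclid_norm v ^+ 2 = v.1 ^+ 2 + v.2 ^+ 2.
Proof. by rewrite sqr_sqrtr// addr_ge0// sqr_ge0. Qed.

(** Lets the measurability and comparison lemmas for the encoder cost serve the decoder too. *)
Lemma decoder_costE (R : realType) : @decoder_cost R = encoder_cost 0.
Proof.
by apply/funext => m; apply/funext => u; rewrite /encoder_cost subr0.
Qed.

Lemma integral_uniform01_sqrB (R : realType) (c : R) :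
  (\int[uniform01 R]_y ((y - c) ^+ 2)%:E =
   (((1 - c) ^+ 3 + c ^+ 3) / 3)%:E)%E.
Proof.
rewrite integral_uniform; first last.
- by move=> x; rewrite lee_fin sqr_ge0.
- apply/measurable_EFinP; apply: measurable_funX.
  exact: measurable_funB.
rewrite subr0 invr1 mul1e.
pose F : R -> R := fun y => (y - c) ^+ 3 / 3.
have dF (x : R) : is_derive x 1 F ((x - c) ^+ 2).
  rewrite /F; apply: is_derive_eq.
  by rewrite /GRing.scale/=; field.
have cF : continuous F.
  by move=> x; apply/differentiable_continuous/derivable1_diffP.
rewrite (@continuous_FTC2 _ _ F)//.
- by rewrite -EFinB /F; congr EFin; field.
- apply: continuous_subspaceT => x.
  by apply/differentiable_continuous/derivable1_diffP.
- split.
  + by [].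
  + exact/cvg_at_right_filter/cF.
  + exact/cvg_at_left_filter/cF.
- by move=> x _; rewrite derive1E derive_val.
Qed.

(** The closed form equals [(c - 1 / 2) ^+ 2 + 1 / 12], the squared bias plus the variance of the
    uniform law. *)
Lemma integral_uniform01_sqrB_min (R : realType) (c : R) :
  (\int[uniform01 R]_y ((y - 1 / 2) ^+ 2)%:E <=
   \int[uniform01 R]_y ((y - c) ^+ 2)%:E)%E.
Proof.
rewrite !integral_uniform01_sqrB lee_fin.
have := sqr_ge0 (c - 1 / 2); nra.
Qed.

Lemma measurable_encoder_cost (R : realType) (b : R * R)
    (ge gd : R * R -> R * R) : policy ge -> policy gd ->
  measurable_fun setT (fun m => (encoder_cost b m (gd (ge m)))%:E).
Proof.
move=> mge mgd; apply/measurable_EFinP.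
have mg : measurable_fun setT (gd \o ge) by exact: measurableT_comp.
have m1 : measurable_fun setT (fun m => (gd (ge m)).1).
  exact: (measurableT_comp measurable_fst mg).
have m2 : measurable_fun setT (fun m => (gd (ge m)).2).
  exact: (measurableT_comp measurable_snd mg).
under eq_fun do rewrite /encoder_cost sqr_euclid_norm/=.
apply: measurable_funD; apply: measurable_funX; apply: measurable_funB => //;
  exact: measurable_funB.
Qed.

Lemma encoder_cost_ge0 (R : realType) (b m u : R * R) :
  0 <= encoder_cost b m u.
Proof. exact: sqr_ge0. Qed.

(** By Tonelli the expected cost is an iterated integral, with [m.1] outside. Costs are nonnegative,
    so no integrability is required and infinite expected costs are covered. *)
Lemma le_expected_encoder_cost (R : realType) (b : R * R)
    (ge gd ge' gd' : R * R -> R * R) :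
    policy ge -> policy gd -> policy ge' -> policy gd' ->
    (forall x : R,
      (\int[uniform01 R]_y (encoder_cost b (x, y) (gd (ge (x, y))))%:E <=
       \int[uniform01 R]_y (encoder_cost b (x, y) (gd' (ge' (x, y))))%:E)%E) ->
  (expected_cost (encoder_cost b) ge gd <=
   expected_cost (encoder_cost b) ge' gd')%E.
Proof.
move=> mge mgd mge' mgd' le_sections.
rewrite /expected_cost unlock /uniform_square.
have mc := measurable_encoder_cost R b ge gd mge mgd.
have mc' := measurable_encoder_cost R b ge' gd' mge' mgd'.
have c0 (g g' : R * R -> R * R) : forall m : R * R, (0 <= (encoder_cost b m (g' (g m)))%:E)%E.
  by move=> m; rewrite lee_fin encoder_cost_ge0.
pose tonelli := @fubini_tonelli1 _ _ _ _ _ (uniform01 R) (uniform01 R).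
rewrite [leLHS](tonelli _ mc (c0 _ _)) [leRHS](tonelli _ mc' (c0 _ _)).
apply: ge0_le_integral => //.
- by move=> x _; apply: integral_ge0 => y _; rewrite lee_fin encoder_cost_ge0.
- exact: measurable_fun_fubini_tonelli_F.
- exact: measurable_fun_fubini_tonelli_F.
- by move=> x _; exact: le_sections.
Qed.

(** The uniform law is dominated by Lebesgue measure, for which countable sets are null. *)
Lemma uniform01_countable (R : realType) (C : set R) :
  countable C -> uniform01 R C = 0%E.
Proof.
move=> cC; have := dominates_uniform_prob (@ltr01 R).
move/null_content_dominatesP; apply; last exact: countable_lebesgue_measure0.
by apply: countable_measurable => // t; exact: measurable_set1.
Qed.

Lemma policy_proj1 (R : realType) (c : R) :
  policy (fun m : R * R => (m.1, c)).
Proof. by apply: measurable_fun_pair. Qed.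

Lemma non_discrete_proj1 (R : realType) (c : R) :
  non_discrete (fun m : R * R => (m.1, c)).
Proof.
move=> [g [[_ cg] [N [mN N0 subN]]]].
(* If the encoder agrees with [g] at [m], then [m.1] is the first coordinate of a value of [g], so
   [m] lies on one of the countably many vertical lines [V] over [C]. *)
pose C := (fst @` range g)%classic.
have cC : countable C by apply: sub_countable cg; exact: card_image_le.
have mC : measurable (C : set (measurableTypeR R)).
  by apply: countable_measurable => // t; exact: measurable_set1.
pose V : set (R * R) := (C `*` setT)%classic.
have mV : measurable (V : set (measurableTypeR R * measurableTypeR R)).
  exact: measurableX.
have V0 : uniform_square R V = 0%E.
  apply: etrans (product_measure1E (uniform01 R) (uniform01 R) mC measurableT) _.
  by rewrite [X in (X * _)%E](uniform01_countable R C cC) mul0e.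
(* The null sets [N] (which contains the disagreement set) and [V] cover the plane, against total
   mass [1]. *)
have : uniform_square R setT = 0%E.
  apply/eqP; rewrite eq_le measure_ge0 andbT.
  have : (uniform_square R (N `|` V)%classic <= 0)%E.
    apply: le_trans (measureU2 (uniform_square R) mN mV) _.
    by rewrite [X in (X + _)%E]N0 [X in (_ + X)%E]V0 adde0.
  apply: le_trans; apply: le_measure; rewrite ?inE//.
    exact: measurableU.
  move=> m _; have [e|ne] := pselect ((m.1, c) = g m); last by left; exact: subN.
  by right; split => //; exists (g m); [exists m|rewrite -e].
by rewrite probability_setT => /eqP; rewrite onee_eq0.
Qed.

Theorem mainTheorem3 (R : realType) :
  exists b : R * R, b != 0 /\
  exists ge gd : R * R -> R * R,
    [/\ nash_equilibrium b ge gd, non_discrete ge & linear ge].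
Proof.
exists (0, 1); split; first by rewrite xpair_eqE negb_and oner_neq0 orbT.
exists (fun m => (m.1, 0)), (fun x => (x.1, 1 / 2)); split; last first.
- by move=> a u v; congr pair; rewrite /= scaler0 addr0.
- exact: non_discrete_proj1.
split; [exact: policy_proj1|exact: policy_proj1|move=> ge' mge'|move=> gd' mgd'].
- rewrite /expected_cost unlock; apply: ge0_le_integral => //.
  + by move=> m _; rewrite lee_fin encoder_cost_ge0.
  + exact: (measurable_encoder_cost R _ _ _ (policy_proj1 R _)
      (policy_proj1 R _)).
  + exact: (measurable_encoder_cost R _ _ _ mge' (policy_proj1 R _)).
  (* The comparison is pointwise: the second-coordinate term is the same for every encoder, and the
     first vanishes on the left. *)
  + move=> m _; rewrite lee_fin /encoder_cost !sqr_euclid_norm/=.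
    by rewrite subrr subr0 expr0n/= add0r lerDr sqr_ge0.
- rewrite decoder_costE.
  have mp := policy_proj1 R; apply: le_expected_encoder_cost => // x.
  (* On the section [m.1 = x] the message is always [(x, 0)], so a rival decoder plays one constant
     action [u] there. *)
  set u := gd' (x, 0).
  (* The intermediate integral drops the rival's first-coordinate error [(x - u.1) ^+ 2]. *)
  apply: le_trans (_ : (\int[uniform01 R]_y ((y - u.2) ^+ 2)%:E <= _)%E).
    rewrite [leLHS](_ : _ = \int[uniform01 R]_y ((y - 1 / 2) ^+ 2)%:E)%E.
      exact: integral_uniform01_sqrB_min.
    apply: eq_integral => y _; rewrite /encoder_cost sqr_euclid_norm/=.
    by rewrite subrr !subr0 expr0n/= add0r.
  apply: ge0_le_integral => //.
  + by move=> y _; rewrite lee_fin sqr_ge0.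
  + apply/measurable_EFinP; apply: measurable_funX.
    exact: measurable_funB.
  + apply/measurable_EFinP.
    under eq_fun do rewrite /encoder_cost sqr_euclid_norm/=.
    apply: measurable_funD => //; apply: measurable_funX.
    by apply: measurable_funB => //; exact: measurable_funB.
  + move=> y _; rewrite lee_fin /encoder_cost sqr_euclid_norm/= !subr0.
    by rewrite lerDr sqr_ge0.
Qed.
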